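(* For every $1\leq p<+\infty$, there exist two frequently hypercyclic weighted shifts on $\ell^p(\mathbb{N})$ with no common frequently hypercyclic vector.
   Context: $\mathbb{N}=\{0,1,2,\ldots\}$. For a bounded sequence $w=(w_n)$ of nonzero real numbers, the weighted shift on $\ell^p(\mathbb{N})$ is $B_w(x_0,x_1,x_2,\ldots)=(w_1x_1,w_2x_2,w_3x_3,\ldots)$. A vector $x\in X$ is frequently hypercyclic for a continuous linear operator $T$ on $X$ if for every non-empty open $U\subset X$, $\underline{d}(\{n\in\mathbb{N}:T^n(x)\in U\})>0$, where $\underline{d}(E)=\liminf_{n\to\infty}\frac{\mathrm{card}([0,n]\cap E)}{n+1}$. The operator $T$ is frequently hypercyclic if it has such a vector. *)

(* Defs.v *)
From HB Require Import structures.
From mathcomp Require Import all_boot all_order all_algebra.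
From mathcomp Require Import all_classical all_reals all_analysis.
From mathcomp Require Import complex.

Set Implicit Arguments.
Unset Strict Implicit.
Unset Printing Implicit Defensive.

Import Order.TTheory GRing.Theory Num.Theory.
Import numFieldNormedType.Exports.

Local Open Scope classical_set_scope.
Local Open Scope ring_scope.

Section frequent_hypercyclicity.
Context {R : realType}.

Definition lower_density (E : set nat) : \bar R :=
  limn_einf (fun n => (#|[pred k : 'I_n.+1 | `[< E k >]]|%:R / n.+1%:R)%:E).

Definition frequently_hypercyclic_vector (X : normedModType R)
    (T : {linear X -> X}) (x : X) : Prop :=
  forall U : set X, open U -> U !=set0 ->
    (0 < lower_density [set n | U (iter n T x)])%E.

Definition frequently_hypercyclic (X : normedModType R)
    (T : {linear X -> X}) : Prop :=
  exists x, frequently_hypercyclic_vector T x.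

End frequent_hypercyclicity.

(* The modulus turns the complex numbers into a normed space over R. *)
Section Rcomplex_normedModType.
Variable R : realType.

HB.instance Definition _ :=
  PseudoMetric.copy (Rcomplex R) (pseudoMetric_normed (Rcomplex R)).
HB.instance Definition _ := isPointed.Build (Rcomplex R) 0.
HB.instance Definition _ :=
  NormedZmod_PseudoMetric_eq.Build R (Rcomplex R) erefl.

Lemma Rcomplex_normrZ (a : R) (z : Rcomplex R) : `|a *: z| = `|a| * `|z|.
Proof.
case: z => x y.
rewrite /Num.norm/= -[RHS]/(`|a| * Num.sqrt (x ^+ 2 + y ^+ 2)).
by rewrite !exprMn -mulrDr sqrtrM ?sqr_ge0// sqrtr_sqr.
Qed.

HB.instance Definition _ :=
  PseudoMetricNormedZmod_Lmodule_isNormedModule.Build R (Rcomplex R)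
    Rcomplex_normrZ.

End Rcomplex_normedModType.

Section ellp_predicate.
Context {R : realType} (V : normedModType R) (p : R).
Implicit Types x y : nat -> V.

Definition elp_enorm x : \bar R :=
  Lnorm (@counting nat R) p%:E (fun n => `|x n|%:E).

Hypothesis p1 : 1 <= p.

Let p0 : 0 < p. Proof. exact: lt_le_trans p1. Qed.

Lemma elp_enorm_ge0 x : (0 <= elp_enorm x)%E.
Proof. exact: Lnorm_ge0. Qed.

Lemma elp_enormE x :
  elp_enorm x = ((\sum_(k <oo) (`|x k| `^ p)%:E) `^ p^-1)%E.
Proof.
rewrite /elp_enorm Lnorm_counting//; congr (_ `^ _)%E.
by apply: eq_eseriesr => k _; rewrite /= normr_id.
Qed.

Lemma elp_enorm_le x y : (forall k, `|x k| <= `|y k|) ->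
  (elp_enorm x <= elp_enorm y)%E.
Proof.
move=> xy; rewrite !elp_enormE gt0_ler_poweR//.
- by rewrite invr_ge0 ltW.
- by rewrite in_itv/= leey andbT nneseries_ge0// => k _ _; rewrite lee_fin powR_ge0.
- by rewrite in_itv/= leey andbT nneseries_ge0// => k _ _; rewrite lee_fin powR_ge0.
apply: lee_nneseries => [k _ _|k _]; rewrite lee_fin ?powR_ge0//.
by rewrite ge0_ler_powR// ?nnegrE// ltW.
Qed.

Lemma elp_enormD x y :
  (elp_enorm (x + y)%R <= elp_enorm x + elp_enorm y)%E.
Proof.
have := @minkowski_EFin _ nat R counting (fun k => `|x k|) (fun k => `|y k|) p
  (fun _ _ _ => I) (fun _ _ _ => I) p1.
apply: le_trans; rewrite /elp_enorm !Lnorm_counting//.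
rewrite gt0_ler_poweR//.
- by rewrite invr_ge0 ltW.
- by rewrite in_itv/= leey andbT nneseries_ge0// => k _ _; rewrite poweR_ge0.
- by rewrite in_itv/= leey andbT nneseries_ge0// => k _ _; rewrite poweR_ge0.
apply: lee_nneseries => [k _ _|k _]; first exact: poweR_ge0.
rewrite /= lee_fin ge0_ler_powR// ?nnegrE// ?(ltW p0)//= normr_id.
by rewrite (le_trans (ler_normD _ _))// ler_norm.
Qed.

Lemma elp_enormZ (a : R) x : elp_enorm (a *: x) = (`|a|%:E * elp_enorm x)%E.
Proof.
have sumge0 : (0 <= \sum_(k <oo) (`|x k| `^ p)%:E)%E.
  by apply: nneseries_ge0 => k _ _; rewrite lee_fin powR_ge0.
rewrite !elp_enormE.
under eq_eseriesr do rewrite normrZ powRM// EFinM.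
rewrite nneseriesZl; last by move=> k _; rewrite lee_fin powR_ge0.
rewrite poweRM ?lee_fin ?powR_ge0//.
by rewrite poweR_EFin -powRrM mulfV ?gt_eqF// powRr1.
Qed.

Lemma elp_enorm0 : elp_enorm 0 = 0%E.
Proof. by rewrite -(scale0r 0) elp_enormZ normr0 mul0e. Qed.

Lemma le_elp_enorm x k : (`|x k|%:E <= elp_enorm x)%E.
Proof.
rewrite elp_enormE.
have -> : `|x k|%:E = ((`|x k| `^ p)%:E `^ p^-1)%E.
  by rewrite poweR_EFin -powRrM mulfV ?gt_eqF// powRr1.
rewrite gt0_ler_poweR//.
- by rewrite invr_ge0 ltW.
- by rewrite in_itv/= leey andbT lee_fin powR_ge0.
- by rewrite in_itv/= leey andbT nneseries_ge0// => i _ _; rewrite lee_fin powR_ge0.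
apply: le_trans (nneseries_lim_ge k.+1 _); last first.
  by move=> i _ _; rewrite lee_fin powR_ge0.
by rewrite big_nat_recr//= leeDr// sume_ge0// => i _; rewrite lee_fin powR_ge0.
Qed.

Lemma elp_enorm_shift x :
  (elp_enorm (fun n => x n.+1) <= elp_enorm x)%E.
Proof.
rewrite !elp_enormE gt0_ler_poweR//.
- by rewrite invr_ge0 ltW.
- by rewrite in_itv/= leey andbT nneseries_ge0// => k _ _; rewrite lee_fin powR_ge0.
- by rewrite in_itv/= leey andbT nneseries_ge0// => k _ _; rewrite lee_fin powR_ge0.
apply: lime_le.
  by apply: is_cvg_nneseries => n _ _; rewrite lee_fin powR_ge0.
apply: nearW => n.
apply: le_trans (nneseries_lim_ge n.+1 _); last first.
  by move=> i _ _; rewrite lee_fin powR_ge0.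
by rewrite [leRHS]big_nat_recl//= leeDr// lee_fin powR_ge0.
Qed.

End ellp_predicate.

(* Meant for V := R^o and V := Rcomplex R: both scalar fields are treated as
   normed spaces over R, which changes neither the topology of the sequence
   space nor the action of a shift with real weights. *)
Definition ellp_pred {R : realType} (V : normedModType R) (p : R)
    (p1 : 1 <= p) : {pred (nat -> V)} :=
  fun x => `[< (elp_enorm p x < +oo)%E >].

Record ellp {R : realType} (V : normedModType R) (p : R) (p1 : 1 <= p) := Ellp {
  ellp_val :> nat -> V ;
  _ : ellp_pred p1 ellp_val }.

Section ellp_normedModType.
Context {R : realType} (V : normedModType R) (p : R) (p1 : 1 <= p).

Lemma ellp_submod_closed : submod_closed (@ellp_pred R V p p1).
Proof.
split=> [|a x y /asboolP xoo /asboolP yoo].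
  by apply/asboolP; rewrite elp_enorm0.
apply/asboolP; rewrite (le_lt_trans (elp_enormD p1 _ _))//.
by rewrite lte_add_pinfty// elp_enormZ// lte_mul_pinfty.
Qed.

HB.instance Definition _ :=
  GRing.isSubmodClosed.Build R (nat -> V) (@ellp_pred R V p p1) ellp_submod_closed.

HB.instance Definition _ :=
  [isSub of ellp V p1 for @ellp_val R V p p1].
HB.instance Definition _ := [Choice of ellp V p1 by <:].
HB.instance Definition _ := [SubChoice_isSubLmodule of ellp V p1 by <:].

Definition ellp_norm (x : ellp V p1) : R := fine (elp_enorm p x).

Lemma ellp_normE (x : ellp V p1) : (ellp_norm x)%:E = elp_enorm p x.
Proof.
case: x => x xp; rewrite fineK// ge0_fin_numE ?elp_enorm_ge0//=.
exact/asboolP.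
Qed.

Lemma ellp_normD (x y : ellp V p1) :
  ellp_norm (x + y) <= ellp_norm x + ellp_norm y.
Proof. by rewrite -lee_fin EFinD !ellp_normE; exact: elp_enormD. Qed.

Lemma ellp_normZ (a : R) (x : ellp V p1) :
  ellp_norm (a *: x) = `|a| * ellp_norm x.
Proof. by apply: EFin_inj; rewrite EFinM !ellp_normE; exact: elp_enormZ. Qed.

Lemma ellp_norm_eq0 (x : ellp V p1) : ellp_norm x = 0 -> x = 0.
Proof.
move=> x0; apply/val_inj/funext => k; apply/normr0_eq0/eqP.
by rewrite eq_le normr_ge0 andbT -lee_fin -x0 ellp_normE le_elp_enorm.
Qed.

HB.instance Definition _ := Lmodule_isNormed.Build R (ellp V p1)
  ellp_normD ellp_normZ ellp_norm_eq0.

End ellp_normedModType.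

(* The entry at index 0 is never used by the weighted shift. *)
Record shift_weight (R : realType) := ShiftWeight {
  weight_val :> nat -> R ;
  weight_bounded : bounded_fun weight_val ;
  weight_neq0 : forall n, weight_val n != 0 }.

Section weighted_shift.
Context {R : realType} (V : normedModType R) (p : R) (p1 : 1 <= p).
Variable w : shift_weight R.

Lemma weighted_shift_bound : exists2 M : R, 0 <= M & forall x : nat -> V,
  (elp_enorm p (fun n => w n.+1 *: x n.+1) <= M%:E * elp_enorm p x)%E.
Proof.
have [M [Mreal wM]] := weight_bounded w.
exists (`|M| + 1) => [|x]; first by rewrite addr_ge0.
have wle n : `|w n| <= `|M| + 1.
  by apply: wM => //; rewrite (le_lt_trans (ler_norm _))// ltrDl.
have p0 : 0 < p by exact: lt_le_trans p1.
rewrite -(@ger0_norm _ (`|M| + 1)) ?addr_ge0// -elp_enormZ//.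
apply: le_trans (elp_enorm_shift p1 _).
apply: elp_enorm_le => // k; rewrite !normrZ ler_wpM2r//.
by rewrite (le_trans (wle _))// ler_norm.
Qed.

Lemma weighted_shift_subproof (x : ellp V p1) :
  ellp_pred p1 (fun n => w n.+1 *: x n.+1).
Proof.
have [M M0 wM] := weighted_shift_bound; apply/asboolP.
rewrite (le_lt_trans (wM x))// lte_mul_pinfty//.
by rewrite -ellp_normE ltry.
Qed.

Definition weighted_shift (x : ellp V p1) : ellp V p1 :=
  Ellp (weighted_shift_subproof x).

Lemma weighted_shift_is_linear : linear weighted_shift.
Proof.
move=> a x y; apply/val_inj/funext => n /=.
rewrite -[LHS]/(w n.+1 *: (a *: x n.+1 + y n.+1)).
rewrite -[RHS]/(a *: (w n.+1 *: x n.+1) + w n.+1 *: y n.+1).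
by rewrite scalerDr !scalerA mulrC.
Qed.

HB.instance Definition _ := GRing.isLinear.Build R (ellp V p1) (ellp V p1)
  *:%R weighted_shift weighted_shift_is_linear.

Lemma weighted_shift_continuous : continuous weighted_shift.
Proof.
apply/linear_bounded_continuous/bounded_funP => r.
have [M M0 wM] := weighted_shift_bound.
exists (M * r) => x xr.
rewrite (@le_trans _ _ (M * `|x|))// ?ler_wpM2l//.
by rewrite -lee_fin EFinM !ellp_normE; exact: wM.
Qed.

End weighted_shift.

Arguments weighted_shift {R} V {p} p1 w x.

(* Main.v *)
Require Import Defs.
From HB Require Import structures.
From mathcomp Require Import all_boot all_order all_algebra.
From mathcomp Require Import all_classical all_reals all_analysis.
From mathcomp Require Import complex.
From mathcomp Require Import zify ring lra.

Set Implicit Arguments.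
Unset Strict Implicit.
Unset Printing Implicit Defensive.

Import Order.TTheory GRing.Theory Num.Theory.
Import numFieldNormedType.Exports.
Local Open Scope classical_set_scope.
Local Open Scope ring_scope.

(** For a weight w write om n = w_1 ... w_n, so that the n-th iterate of the
    shift sends x to the sequence k |-> (om (n + k) / om k) x_(n + k)
    ([iter_weighted_shift]).  Take one shift with om n = (n + 1)^3 and the
    other with om n = 8^n, i.e. constant weight 8.

    They share no frequently hypercyclic vector because the products grow at
    incomparable speeds.  Let E be the set of n for which the first orbit of x
    is at time n near a vector whose entry at 0 has norm 2, and F the set of
    m for which the second orbit is at time m in the unit ball.  If n is in E
    then x_n has norm more than (n + 1)^(-3).  If m is in F then every
    entry of x from index m on is smaller than 8^(-m).  So m <= n forces
    8^m < (n + 1)^3, i.e. 2^m <= n: below n, the set F lives in [0, log_2 n].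
    As E is infinite, F has lower density 0 ([no_common_vector],
    [exponentially_separated_density]).

    Each of the two shifts is frequently hypercyclic because om n >= (n + 1)^3
    ([frequently_hypercyclic_of_growth]).  List a dense family of finitely
    supported vectors y_0, y_1, ... so slowly that y_v is supported in [0, v]
    and has om k |y_v k| <= v ([tame_dense_sequence]).  Let pos be an
    increasing sequence of times, the i-th of which is devoted to y_v, where
    v = label i is the 2-adic valuation of i + 1, and such that consecutive
    times are separated by more than the sum of their labels.  As valuations
    are small on average, pos i = O(i), so that each y_v is served with positive
    lower density ([lower_density_label]).  Let x consist of blocks, the block
    starting at pos i being a vector that the pos i-th iterate sends to
    y_(label i).  At time pos i the orbit of x is y_(label i) plus the later
    blocks; an entry of these at index k, from a block of label l, has norm at
    most l / om k, and the gaps give l <= k.  The error is thus dominated by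
    k / (k + 1)^3, and it vanishes for k <= label i, hence it is small in every
    l^p once label i is large. *)

(** * Lower density *)

Definition hits (E : set nat) (n : nat) : nat :=
  #|[pred k : 'I_n.+1 | `[< E k >]]|.

(** Positive lower density in counting form, which both halves of the proof
    manipulate: the liminf is the supremum of the infima of the tails. *)
Lemma lower_density_gt0P (R : realType) (E : set nat) :
  (0 < @lower_density R E)%E <->
  exists2 d : R, 0 < d &
    exists N, forall n, (N <= n)%N -> d * n.+1%:R <= (hits E n)%:R.
Proof.
rewrite /lower_density limn_einf_lim.
set u := (fun n : nat => _).
have -> : limn (einfs u) = ereal_sup (range (einfs u)).
  by apply/cvg_lim => //; exact: cvg_einfs_sup.
split.
  move=> /ereal_sup_gt[_ [N _ <-]] posN.
  have [d d0 dN] : exists2 d : R, 0 < d & (d%:E <= einfs u N)%E.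
    move: posN; case: (einfs u N) => [r| |] //=.
      by rewrite lte_fin => r0; exists r.
    by exists 1 => //; rewrite leey.
  exists d => //; exists N => n Nn.
  have : (d%:E <= u n)%E.
    by apply: (le_trans dN); apply: ge_ereal_inf; exists (u n) => //; exists n.
  by rewrite lee_fin ler_pdivlMr.
move=> [d d0 [N dN]].
apply: (@lt_le_trans _ _ d%:E); first by rewrite lte_fin.
apply: (@le_trans _ _ (einfs u N)); last by apply: ereal_sup_ubound; exists N.
apply: le_ereal_inf_tmp => _ [n /= Nn <-].
by rewrite lee_fin ler_pdivlMr// dN.
Qed.

Lemma hits_ge (E : set nat) (g : nat -> nat) (k n : nat) :
    injective g -> (forall q, (q < k)%N -> (g q <= n)%N) ->
    (forall q, E (g q)) ->
  (k <= hits E n)%N.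
Proof.
move=> ginj gn gE.
rewrite -[k]card_ord -(@card_imset _ _ (fun q : 'I_k => inord (g q) : 'I_n.+1)).
  apply/subset_leq_card/fintype.subsetP => i /imsetP[q _ ->].
  by rewrite inE/= inordK ?ltnS ?gn//; apply/asboolP.
move=> q r /(congr1 val)/=; rewrite !inordK ?ltnS ?gn// => /ginj/val_inj.
exact.
Qed.

Lemma lower_density_gt0 (R : realType) (E : set nat) (g : nat -> nat) (M : nat) :
    injective g -> (forall q, (g q <= M * q.+1)%N) -> (forall q, E (g q)) ->
  (0 < @lower_density R E)%E.
Proof.
move=> ginj gM gE; apply/lower_density_gt0P.
(* Otherwise g 0 = g 1 = 0. *)
have M0 : (0 < M)%N.
  by have := gM 1%N; have := gM 0%N; case: M {gM} => // /[!leqn0] /eqP <- /eqP /ginj.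
have M2 : 0 < (2 * M)%:R :> R by rewrite ltr0n muln_gt0.
exists (2 * M)%:R^-1; first by rewrite invr_gt0.
exists M => n Mn; rewrite mulrC ler_pdivrMr// -natrM ler_nat.
have : (n %/ M <= hits E n)%N.
  apply: hits_ge gE => // q qn; rewrite (leq_trans (gM q))//.
  by rewrite (leq_trans _ (leq_divM n M))// mulnC leq_mul2r qn orbT.
have := ltn_ceil n M0; have : (0 < n %/ M)%N by rewrite divn_gt0.
by nia.
Qed.

Lemma hits_exists_ge (E : set nat) (k n : nat) :
  (k < hits E n)%N -> exists2 m, (k <= m <= n)%N & E m.
Proof.
move=> kE; apply/not_exists2P => noE; move: kE; apply/negP; rewrite -leqNgt.
have Ek (i : 'I_n.+1) : `[< E i >] -> (i < k)%N.
  move=> /asboolP Ei; case: (noE i) => // /negP.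
  by have := ltn_ord i; lia.
rewrite -[leqRHS](size_iota 0 k) /hits cardE -(size_map val); apply: uniq_leq_size.
  by rewrite (map_inj_uniq val_inj) enum_uniq.
by move=> _ /mapP[i + ->]; rewrite mem_enum mem_iota => /Ek.
Qed.

Lemma lower_density_unbounded (R : realType) (E : set nat) (N : nat) :
  (0 < @lower_density R E)%E -> exists2 n, (N <= n)%N & E n.
Proof.
move=> /lower_density_gt0P[d d0 [K dK]].
have [k kd] : exists k : nat, N.+1%:R / d < k%:R.
  by exists (Num.truncn (N.+1%:R / d)).+1; rewrite truncnS_gt.
have [m /andP[Nm _] Em] : exists2 m, (N <= m <= maxn K k)%N & E m.
  apply: hits_exists_ge; rewrite -(ltr_nat R).
  apply: lt_le_trans (dK _ (leq_maxl _ _)).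
  rewrite mulrC -ltr_pdivrMr//; apply: (@lt_trans _ _ k%:R).
    by apply: le_lt_trans kd; rewrite ler_pM2r ?invr_gt0// ler_nat.
  by rewrite ltr_nat ltnS leq_maxr.
by exists m.
Qed.

(** Below a point n of E there are at most 1 + log_2 n points of F, and n can be
    taken arbitrarily large in E. *)
Lemma exponentially_separated_density (R : realType) (E F : set nat) :
    (forall n m, E n -> F m -> (m <= n)%N -> (2 ^ m <= n)%N) ->
    (0 < @lower_density R E)%E ->
  ~ (0 < @lower_density R F)%E.
Proof.
move=> EF Epos /lower_density_gt0P[d d0 [N dN]].
(* A point n > 4 / d^2 of E contradicts (d (n + 1))^2 <= 4 * 2^h <= 4 n. *)
have [k kd] : exists k : nat, 4 / d ^+ 2 < k%:R.
  by exists (Num.truncn (4 / d ^+ 2)).+1; rewrite truncnS_gt.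
have [n kNn En] := lower_density_unbounded (maxn N k) Epos.
have [Nn kn] : (N <= n)%N /\ (k <= n)%N by lia.
have := dN _ Nn; case Eh : (hits F n) => [|h] dh.
  by move: dh; rewrite leNgt mulr_gt0// ltr0n.
have [m /andP[hm mn] Fm] : exists2 m, (h <= m <= n)%N & F m.
  by apply: hits_exists_ge; rewrite Eh.
have hn : (2 ^ h <= n)%N by rewrite (leq_trans _ (EF _ _ En Fm mn))// leq_pexp2l.
have sq : (h.+1 ^ 2 <= 4 * 2 ^ h)%N.
  elim: h {Eh dh hm hn} => // -[//|[//|h]].
  rewrite !(expnS 2) -!mulnn; set t := (2 ^ h)%N; nia.
have : (d * n.+1%:R) ^+ 2 <= 4 * n.+1%:R.
  apply: (@le_trans _ _ (h.+1%:R ^+ 2)).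
    by rewrite lerXn2r// nnegrE// mulr_ge0 ?ltW.
  by rewrite -natrX -natrM ler_nat; lia.
have : 4 / d ^+ 2 < n.+1%:R.
  by apply: (lt_le_trans kd); rewrite ler_nat; lia.
rewrite ltr_pdivrMr ?exprn_gt0// -(ltr_pM2r (ltr0Sn R n)).
rewrite exprMn (expr2 n.+1%:R); lra.
Qed.

(** * Times of approach to the targets *)

(** The ruler sequence 0, 1, 0, 2, 0, 1, 0, 3, ...: every value v recurs with
    period 2^(v+1), and the mean is finite. *)
Definition label (i : nat) : nat := logn 2 i.+1.

(** The gap after the i-th time exceeds label i + label i.+1, which makes room
    for the support of the target on one side and keeps the error small on the
    other. *)
Definition pos (i : nat) : nat := (\sum_(t < i) (label t + label t.+1 + 1))%N.

Lemma posS i : pos i.+1 = (pos i + (label i + label i.+1 + 1))%N.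
Proof. by rewrite /pos big_ord_recr. Qed.

(** The separation needed between any two targets, not just consecutive ones:
    it controls the larger of the two labels, so the times serving a single
    label cannot form a periodic set once infinitely many labels occur. *)
Lemma pos_gap i j : (i < j)%N -> (pos i + label i + label j < pos j)%N.
Proof.
elim: j => // j IH; rewrite ltnS leq_eqVlt => /predU1P[->|/IH]; rewrite posS; lia.
Qed.

Lemma pos_inj : injective pos.
Proof. by move=> i j; case: (ltngtP i j) => // /pos_gap; lia. Qed.

Lemma pos_mono i j : (i <= j)%N -> (pos i <= pos j)%N.
Proof. by rewrite leq_eqVlt => /predU1P[->//|/pos_gap]; lia. Qed.

Lemma pos_ge i : (i <= pos i)%N.
Proof. by elim: i => // i IH; rewrite posS; lia. Qed.

(** Legendre: the valuation of n! is n/2 + n/4 + ... with floors.  This is the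
    bound on the average of the ruler sequence. *)
Lemma logn2_fact_le n : (logn 2 n`! <= n)%N.
Proof.
rewrite logn_fact//.
(* Decoupling the number of terms from m lets the induction halve m. *)
suff H N m : (\sum_(1 <= k < N.+1) m %/ 2 ^ k <= m)%N by exact: H.
elim: N m => [|N IH] m; first by rewrite big_geq.
rewrite big_nat_recl//.
under eq_bigr do rewrite expnS divnMA.
have := IH (m %/ 2)%N; rewrite expn1; lia.
Qed.

(** The labels add up to valuations of factorials, so the gaps are bounded on
    average although not uniformly. *)
Lemma pos_le i : (pos i <= 3 * i.+1)%N.
Proof.
have logS j : logn 2 j.+1`! = (label j + logn 2 j`!)%N.
  by rewrite factS lognM ?fact_gt0.
have : pos i = (logn 2 i`! + logn 2 i.+1`! + i)%N.
  elim: i => [|i IH]; first by rewrite /pos big_ord0.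
  by rewrite posS IH (logS i.+1) !(logS i); lia.
by have := logn2_fact_le i; have := logn2_fact_le i.+1; lia.
Qed.

Lemma pos_block m : exists i, (pos i <= m < pos i.+1)%N.
Proof.
elim: m => [|m [i /andP[im mi]]].
  by exists 0%N; rewrite posS /pos big_ord0; lia.
have [mi'|mi'] := ltnP m.+1 (pos i.+1); first by exists i; lia.
by exists i.+1; rewrite mi' posS; lia.
Qed.

Lemma pos_block_uniq m i j :
  (pos i <= m < pos i.+1)%N -> (pos j <= m < pos j.+1)%N -> i = j.
Proof.
by case: (ltngtP i j) => // /pos_mono; lia.
Qed.

(** The indices i with label v are those with i + 1 = 2^v (2q + 1), and pos is
    at most linear. *)
Lemma lower_density_label (R : realType) (E : set nat) (v : nat) :
  (forall i, label i = v -> E (pos i)) -> (0 < @lower_density R E)%E.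
Proof.
move=> labelE.
pose g q := pos (2 ^ v * q.*2.+1).-1.
have posK q : (2 ^ v * q.*2.+1).-1.+1 = (2 ^ v * q.*2.+1)%N.
  by rewrite prednK// muln_gt0 expn_gt0.
apply: (@lower_density_gt0 _ _ g (6 * 2 ^ v)) => [q r /pos_inj/(congr1 S)|q|q].
- by rewrite !posK => /eqP; rewrite eqn_pmul2l ?expn_gt0// eqSS => /eqP; lia.
- rewrite /g (leq_trans (pos_le _))// posK; nia.
- apply: labelE.
  rewrite /label posK lognM ?expn_gt0// pfactorK//.
  by rewrite logn_coprime ?addn0// coprime2n /= odd_double.
Qed.

(** * Norm estimates in l^p *)

Lemma elp_enorm_le_partial (R : realType) (V : normedModType R) (p : R)
    (p1 : 1 <= p) (c : R) (x : nat -> V) : 0 <= c ->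
    (forall n, \sum_(0 <= k < n) `|x k| `^ p <= c `^ p) ->
  (elp_enorm p x <= c%:E)%E.
Proof.
move=> c0 xc; have p0 : 0 < p by exact: lt_le_trans p1.
have -> : c%:E = ((c `^ p)%:E `^ p^-1)%E.
  by rewrite poweR_EFin -powRrM mulfV ?gt_eqF// powRr1.
have sum0 k : (0 <= (`|x k| `^ p)%:E)%E by rewrite lee_fin powR_ge0.
rewrite elp_enormE// gt0_ler_poweR//.
- by rewrite invr_ge0 ltW.
- by rewrite in_itv/= leey andbT nneseries_ge0.
- by rewrite in_itv/= leey andbT lee_fin powR_ge0.
apply: lime_le; first exact: is_cvg_nneseries.
by apply: nearW => n; rewrite sumEFin lee_fin.
Qed.

Lemma powR_le_self (R : realType) (p a : R) :
  1 <= p -> 0 <= a <= 1 -> a `^ p <= a.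
Proof.
move=> p1 /andP[a0 a1]; move: a0; rewrite le_eqVlt => /predU1P[<-|a0].
  by rewrite powR0// gt_eqF// (lt_le_trans _ p1).
by rewrite ge1r_powR// a0.
Qed.

(** A majorant whose tail from N is exactly 1 / (N + 1), by telescoping. *)
Definition telescope_bound (R : realType) (k : nat) : R :=
  (k.+1%:R * k.+2%:R)^-1.

(** One estimate for all p >= 1: the majorant is at most 1, so raising to the
    power p only decreases it. *)
Lemma elp_enorm_telescope (R : realType) (V : normedModType R) (p : R)
    (p1 : 1 <= p) (N : nat) (c : R) (x : nat -> V) :
    0 <= c -> N.+1%:R^-1 <= c `^ p ->
    (forall k, (k < N)%N -> x k = 0) ->
    (forall k, `|x k| <= telescope_bound R k) ->
  (elp_enorm p x <= c%:E)%E.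
Proof.
move=> c0 Nc x0 xle; apply: elp_enorm_le_partial => // n.
apply: le_trans Nc.
have term k : `|x k| `^ p <= telescope_bound R k.
  apply: le_trans (xle k); apply: powR_le_self => //.
  rewrite normr_ge0 (le_trans (xle k))// invf_le1 ?mulr_gt0//.
  by rewrite -natrM ler1n muln_gt0.
have [nN|/ltnW Nn] := leqP n N.
  rewrite big_nat big1 ?invr_ge0// => k /andP[_ kn].
  by rewrite x0 ?(leq_trans kn)// normr0 powR0// gt_eqF// (lt_le_trans _ p1).
suff : \sum_(0 <= k < n) `|x k| `^ p <= N.+1%:R^-1 - n.+1%:R^-1.
  by move=> /le_trans; apply; rewrite gerBl invr_ge0.
elim: n Nn => [|n IH]; rewrite leq_eqVlt => /predU1P[Nn|Nn].
- by rewrite big_geq// Nn subrr.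
- by [].
- rewrite big_nat big1 ?Nn ?subrr// => k /andP[_ kn].
  by rewrite x0 ?Nn// normr0 powR0// gt_eqF// (lt_le_trans _ p1).
- rewrite big_nat_recr//=; apply: le_trans (lerD (IH Nn) (term n)) _.
  suff -> : telescope_bound R n = n.+1%:R^-1 - n.+2%:R^-1.
    by rewrite addrA subrK.
  have n1 : n.+1%:R != 0 :> R by rewrite pnatr_eq0.
  have n2 : n.+1%:R + 1 != 0 :> R by rewrite natr1 pnatr_eq0.
  rewrite /telescope_bound -(natr1 n.+1); move: n1 n2.
  by move: (n.+1%:R : R) => a a0 a1; field; rewrite a0 a1.
Qed.

(** Finite lists of indices are used as codes for finitely supported vectors
    because they form a countable type. *)
Definition pad (R : realType) (V : normedModType R) (q : nat -> V)
  (u : seq nat) (k : nat) : V := if (k < size u)%N then q (nth 0%N u k) else 0.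

(** Truncate where the tail has p-th power sum at most e^p / 2, and approximate
    the d remaining entries closely enough to contribute at most e^p / 2. *)
Lemma pad_approx (R : realType) (V : normedModType R) (p : R) (p1 : 1 <= p)
    (q : nat -> V) :
    (forall v (e : R), 0 < e -> exists i, `|v - q i| < e) ->
  forall (z : nat -> V) (e : R), (elp_enorm p z < +oo)%E -> 0 < e ->
  exists u, (elp_enorm p (z - pad q u)%R <= e%:E)%E.
Proof.
move=> qd z e zoo e0.
have p0 : 0 < p by exact: lt_le_trans p1.
have ep0 : 0 < e `^ p by rewrite powR_gt0.
have zk k : (0 <= (`|z k| `^ p)%:E)%E by rewrite lee_fin powR_ge0.
have soo : (\sum_(k <oo) (`|z k| `^ p)%:E < +oo)%E.
  by move: zoo; rewrite elp_enormE//; apply: lty_poweRy; rewrite invr_eq0 gt_eqF.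
have [d dtail] : exists d, forall n,
    \sum_(d <= k < n) `|z k| `^ p <= e `^ p / 2.
  have /fine_cvgP[+ /cvgrPdist_le] := nneseries_tail_cvg soo (fun k _ => zk k).
  move=> finN /(_ (e `^ p / 2) _)[|N _ NE]; first by rewrite divr_gt0.
  case: finN => M _ finN; exists (maxn N M) => n.
  have := NE (maxn N M) (leq_maxl _ _); rewrite sub0r normrN.
  move/(le_trans (ler_norm _)); apply: le_trans.
  rewrite -lee_fin fineK; last by apply: finN; exact: leq_maxr.
  rewrite -sumEFin.
  exact: (nneseries_lim_ge n (fun i _ _ => zk i)).
(* Chosen so that d * h^p <= e^p / 2, using t^p <= t for t in [0, 1]. *)
pose h := e / (2 * d.+1%:R).
have h0 : 0 < h by rewrite divr_gt0// mulr_gt0.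
have hp : h `^ p <= e `^ p / (2 * d.+1%:R).
  rewrite /h powRM ?invr_ge0 ?mulr_ge0 ?(ltW e0)// ler_wpM2l ?(ltW ep0)//.
  apply: powR_le_self => //; rewrite invr_ge0 mulr_ge0//=.
  by rewrite invf_le1 ?mulr_gt0// -natrM ler1n.
have [c cz] := choice (fun k => qd (z k) h h0).
exists (mkseq c d); apply: elp_enorm_le_partial => //; first exact: ltW.
have term k : `|(z - pad q (mkseq c d)) k| `^ p <=
    if (k < d)%N then e `^ p / (2 * d.+1%:R) else `|z k| `^ p.
  rewrite -[X in `|X|]/(z k - pad q (mkseq c d) k) /pad size_mkseq.
  case: ifPn => kd; last by rewrite subr0.
  apply: le_trans hp; rewrite ge0_ler_powR ?nnegrE// ?ltW//.
  by rewrite nth_mkseq.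
have half n : (n <= d)%N ->
    \sum_(0 <= k < n) `|(z - pad q (mkseq c d)) k| `^ p <= e `^ p / 2.
  move=> nd; apply: (@le_trans _ _ (\sum_(0 <= k < n) e `^ p / (2 * d.+1%:R))).
    by apply: ler_sum_nat => k /andP[_ kn]; have := term k; rewrite (leq_trans kn).
  rewrite big_const_nat subn0 iter_addr_0 -[leLHS]mulr_natl.
  have -> : n%:R * (e `^ p / (2 * d.+1%:R)) = e `^ p / 2 * (n%:R / d.+1%:R).
    by rewrite invfM !mulrA; congr (_ / _); rewrite -mulrA mulrC.
  rewrite -[leRHS]mulr1 ler_wpM2l ?divr_ge0 ?(ltW ep0)//.
  by rewrite ler_pdivrMr// mul1r ler_nat leqW.
move=> n; have [nd|/ltnW dn] := leqP n d.
  by apply: (le_trans (half _ nd)); rewrite ler_pdivrMr// ler_peMr ?(ltW ep0) ?ler1n.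
rewrite (@big_cat_nat _ _ _ d)//= [leRHS]splitr lerD// ?half//.
apply: le_trans (dtail n); apply: ler_sum_nat => k /andP[dk _].
by have := term k; rewrite ltnNge dk.
Qed.

(** * A slowly growing dense sequence of targets *)

(** Pairing a code with a free parameter gives it arbitrarily large indices. *)
Lemma pickle_pair_unbounded (T : countType) (u : T) (N : nat) :
  exists t : nat, (N <= pickle (u, t))%N.
Proof.
apply: contrapT => /forallNP tN.
have tlt (t : nat) : (pickle (u, t) < N)%N by have := tN t; lia.
pose f (t : 'I_N.+1) := Ordinal (tlt t).
have finj : injective f.
  by move=> s t /(congr1 val)/= /(pcan_inj pickleK)[] /val_inj.
by have := leq_card f finj; rewrite !card_ord ltnn.
Qed.

(** Every finitely supported vector with entries in the range of q is listed
    infinitely often, but only at indices v that are large compared with its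
    support and its size; the other indices are filled with 0.  The list then
    grows slowly enough for the series defining a frequently hypercyclic vector
    to converge, and it remains dense along every tail. *)
Lemma tame_dense_sequence (R : realType) (V : normedModType R) (p : R)
    (p1 : 1 <= p) (q : nat -> V) (om : nat -> R) :
    (forall v (e : R), 0 < e -> exists i, `|v - q i| < e) ->
  exists y : nat -> nat -> V,
    [/\ forall v k, (v < k)%N -> y v k = 0,
        forall v k, om k * `|y v k| <= v%:R &
        forall (z : nat -> V) (e : R) N, (elp_enorm p z < +oo)%E -> 0 < e ->
          exists2 v, (N <= v)%N & (elp_enorm p (z - y v)%R <= e%:E)%E].
Proof.
move=> qd.
pose tame (u : seq nat) v := (size u <= v)%N &&
  all (fun k => om k * `|pad q u k| <= v%:R) (iota 0 (size u)).
pose y v : nat -> V := if unpickle v is Some ut then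
  if tame (ut : seq nat * nat).1 v then pad q ut.1 else 0 else 0.
have yE v : (exists2 u, y v = pad q u & tame u v) \/ y v = 0.
  rewrite /y; case: unpickle => [ut|]; last by right.
  by case: ifP => tu; [left; exists ut.1|right].
exists y; split => [v k vk|v k|z e N zoo e0].
- case: (yE v) => [[u -> /andP[uv _]]|->//].
  by rewrite /pad ltnNge (leq_trans uv)// ltnW.
- case: (yE v) => [[u -> /andP[_ /allP uv]]|->]; last by rewrite normr0 mulr0.
  have [ku|uk] := ltnP k (size u); first by apply: uv; rewrite mem_iota.
  by rewrite /pad ltnNge uk normr0 mulr0.
- have [u zu] := pad_approx p1 qd zoo e0.
  pose B := (\max_(k < size u) Num.truncn (om k * `|pad q u k|)).+1.
  have [t Nt] := pickle_pair_unbounded u (maxn N (maxn (size u) B)).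
  have := pickleK (u, t); move: (pickle (u, t)) Nt => v Nv vK.
  have [Nv' uv Bv] : [/\ (N <= v)%N, (size u <= v)%N & (B <= v)%N].
    by split; lia.
  exists v => //; suff -> : y v = pad q u by [].
  rewrite /y vK ifT//; apply/andP; split => //=.
  apply/allP => k; rewrite mem_iota /= add0n => ku.
  apply: (@le_trans _ _ B%:R); last by rewrite ler_nat.
  apply/ltW/(lt_le_trans (truncnS_gt _)); rewrite ler_nat ltnS.
  exact: (leq_bigmax (Ordinal ku)).
Qed.

(** * Frequently hypercyclic shifts *)

Lemma iter_weighted_shift (R : realType) (V : normedModType R) (p : R)
    (p1 : 1 <= p) (w : shift_weight R) (om : nat -> R) :
    (forall n, 0 < om n) -> (forall n, w n.+1 = om n.+1 / om n) ->
  forall (x : ellp V p1) n k,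
    ellp_val (iter n (weighted_shift V p1 w) x) k =
    (om (n + k)%N / om k) *: ellp_val x (n + k)%N.
Proof.
move=> om0 wE x n; elim: n => [|n IH] k.
  by rewrite add0n divff ?scale1r// gt_eqF.
rewrite iterS -[LHS]/(w k.+1 *: ellp_val (iter n _ x) k.+1) IH.
rewrite scalerA wE addnS addSn; congr (_ *: _).
by rewrite mulrC mulrA divfK// gt_eqF.
Qed.

(** The vector is a concatenation of blocks; the block at pos i is a preimage
    of the target y (label i) under the pos i-th iterate.  Cubic growth is what
    makes k / om k summable, with the explicit telescoping majorant. *)
Lemma frequently_hypercyclic_of_growth (R : realType) (V : normedModType R)
    (p : R) (p1 : 1 <= p) (q : nat -> V) (w : shift_weight R) (om : nat -> R) :
    (forall v (e : R), 0 < e -> exists i, `|v - q i| < e) ->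
    (forall n, w n.+1 = om n.+1 / om n) ->
    (forall n, n.+1%:R ^+ 3 <= om n) ->
  frequently_hypercyclic (weighted_shift V p1 w).
Proof.
move=> qd wE omge.
have om0 n : 0 < om n by apply: lt_le_trans (omge n); rewrite exprn_gt0.
have [y [ysupp ybound ydense]] := tame_dense_sequence p1 om qd.
(* [b m] is the block containing the index m. *)
have [b bP] := choice pos_block.
have small (c k : nat) : (c <= k)%N -> c%:R / om k <= telescope_bound R k.
  move=> ck; rewrite ler_pdivrMr// mulrC ler_pdivlMr ?mulr_gt0//.
  apply: le_trans (omge k); rewrite -natrX -!natrM ler_nat.
  apply: leq_trans (leq_mul ck (leqnn _)) _; rewrite !expnS expn0; nia.
pose x m := (om (m - pos (b m))%N / om m) *: y (label (b m)) (m - pos (b m))%N.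
have xle m : `|x m| <= (label (b m))%:R / om m.
  rewrite normrZ ger0_norm ?divr_ge0 ?(ltW (om0 _))//.
  by rewrite mulrAC ler_pM2r ?invr_gt0.
(* Here label (b m) <= b m <= pos (b m) <= m. *)
have xp : ellp_pred p1 x.
  apply/asboolP; apply: (@le_lt_trans _ _ 1%:E); last exact: ltry.
  apply: (@elp_enorm_telescope _ _ _ p1 0) => //; first by rewrite invr1 powR1.
  move=> k; apply: (le_trans (xle k)); apply: small.
  have /andP[bk _] := bP k; apply: leq_trans bk.
  by apply: leq_trans (pos_ge _); rewrite -ltnS ltn_logl.
have orbit i k : (k <= label i)%N ->
    (om (pos i + k)%N / om k) *: x (pos i + k)%N = y (label i) k.
  move=> ki; rewrite /x.
  have -> : b (pos i + k)%N = i.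
    by apply: (pos_block_uniq (bP _)); rewrite posS; lia.
  by rewrite addKn scalerA mulrC mulrA divfK ?divff ?scale1r// gt_eqF.
have err i k : `|y (label i) k - (om (pos i + k)%N / om k) *: x (pos i + k)%N| <=
    telescope_bound R k.
  have [ki|ik] := leqP k (label i).
    by rewrite orbit// subrr normr0 invr_ge0 mulr_ge0.
  rewrite ysupp// sub0r normrN; set m := (pos i + k)%N.
  have /andP[bm mb] := bP m.
  have [bi|bi] := eqVneq (b m) i.
    by rewrite /x bi /m addKn ysupp// !scaler0 normr0 invr_ge0 mulr_ge0.
  (* Earlier blocks have been shifted out by time pos i. *)
  have ib : (i < b m)%N.
    rewrite ltn_neqAle eq_sym bi /= leqNgt; apply/negP => /pos_mono; lia.
  apply: (@le_trans _ _ ((label (b m))%:R / om k)).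
    rewrite normrZ ger0_norm ?divr_ge0 ?(ltW (om0 _))//.
    apply: le_trans (ler_wpM2l _ (xle m)) _.
      by rewrite divr_ge0 ?(ltW (om0 _)).
    by rewrite mulrC mulrA divfK// gt_eqF.
  by apply: small; have := pos_gap ib; lia.
exists (Ellp xp) => U Uopen [z Uz].
have /nbhs_ballP[e /= e0 zeU] : nbhs z U by exact: open_nbhs_nbhs.
pose c := e / 3; have c0 : 0 < c by rewrite divr_gt0.
have [N Nc] : exists N : nat, N.+1%:R^-1 <= c `^ p.
  exists (Num.truncn (c `^ p)^-1).
  by rewrite -[leRHS]invrK lef_pV2 ?posrE ?invr_gt0 ?powR_gt0// ltW// truncnS_gt.
have zoo : (elp_enorm p (ellp_val z) < +oo)%E by rewrite -ellp_normE ltry.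
have [v Nv zv] := ydense _ c N zoo c0.
apply: (@lower_density_label _ _ v) => i iv; apply: zeU.
rewrite -ball_normE /= -lte_fin -[_%:E]/((ellp_norm _)%:E) ellp_normE.
set T := iter _ _ _.
rewrite (_ : ellp_val _ = (ellp_val z - y v) + (y v - ellp_val T)); last first.
  by rewrite addrA subrK.
apply: le_lt_trans (elp_enormD p1 _ _) _.
apply: (@le_lt_trans _ _ (c%:E + c%:E)%E).
  apply: leeD => //; apply: (@elp_enorm_telescope _ _ _ p1 v).
  - exact: ltW.
  - by apply: le_trans Nc; rewrite lef_pV2 ?posrE// ler_nat.
  - move=> k kv; rewrite -[LHS]/(y v k - ellp_val T k) /T.
    by rewrite (iter_weighted_shift om0 wE)/= orbit ?iv ?subrr// ltnW.
  - move=> k; rewrite -[X in `|X|]/(y v k - ellp_val T k) /T.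
    by rewrite (iter_weighted_shift om0 wE)/= -iv; exact: err.
by rewrite -EFinD lte_fin /c; lra.
Qed.

(** * Two shifts without common frequently hypercyclic vector *)

Lemma weight_of_products (R : realType) (om : nat -> R) (M : R) :
    (forall n, 0 < om n) -> (forall n, om n.+1 <= M * om n) ->
  exists w : shift_weight R, forall n, w n.+1 = om n.+1 / om n.
Proof.
move=> om0 omM; pose w n := om n / om n.-1.
have wbounded : bounded_fun w.
  (* The summand 1 accounts for the entry om 0 / om 0 at index 0. *)
  exists (`|M| + 1); split; first exact: num_real.
  move=> B MB n _; apply: (le_trans _ (ltW MB)).
  rewrite /w ger0_norm ?divr_ge0 ?(ltW (om0 _))//.
  case: n => [|n]; first by rewrite divff ?lerDr// gt_eqF.
  rewrite ler_pdivrMr//; apply: (le_trans (omM n)).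
  by rewrite ler_pM2r// (le_trans (ler_norm _))// lerDl.
have w0 n : w n != 0 by rewrite mulf_neq0 ?invr_eq0 ?gt_eqF.
by exists (ShiftWeight wbounded w0).
Qed.

Lemma ellp_coord_le (R : realType) (V : normedModType R) (p : R) (p1 : 1 <= p)
    (x : ellp V p1) k : `|ellp_val x k| <= `|x|.
Proof.
by rewrite -lee_fin -[(`|x|)%:E]/((ellp_norm x)%:E) ellp_normE le_elp_enorm.
Qed.

Lemma ellp_single (R : realType) (V : normedModType R) (p : R) (p1 : 1 <= p)
    (v : V) : exists x : ellp V p1, ellp_val x 0%N = v.
Proof.
pose x (k : nat) : V := if k is 0%N then v else 0.
suff xp : ellp_pred p1 x by exists (Ellp xp).
apply/asboolP; apply: (@le_lt_trans _ _ `|v|%:E); last exact: ltry.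
apply: elp_enorm_le_partial => // -[|n]; first by rewrite big_geq ?powR_ge0.
rewrite big_nat_recl//= big1 ?addr0// => k _.
by rewrite normr0 powR0// gt_eqF// (lt_le_trans _ p1).
Qed.

(** If the first orbit is at time n near a vector with first entry of norm 2,
    then (n + 1)^3 |x_n| > 1; if the second is in the unit ball at time m <= n,
    then 8^m |x_n| < 1.  Hence 8^m < (n + 1)^3, i.e. 2^m <= n. *)
Lemma no_common_vector (R : realType) (V : normedModType R) (p : R)
    (p1 : 1 <= p) (v : V) (w1 w2 : shift_weight R) :
    `|v| = 2 ->
    (forall n, w1 n.+1 = n.+2%:R ^+ 3 / n.+1%:R ^+ 3) ->
    (forall n, w2 n.+1 = 8 ^+ n.+1 / 8 ^+ n) ->
  ~ exists x : ellp V p1,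
      frequently_hypercyclic_vector (weighted_shift V p1 w1) x /\
      frequently_hypercyclic_vector (weighted_shift V p1 w2) x.
Proof.
move=> v2 w1E w2E [x [fx1 fx2]].
have [u uv] := ellp_single p1 v.
have := fx2 (ball 0 1) (ball_open _ (1 : R)) (ex_intro _ 0 (ballxx _ (@ltr01 R))).
have := fx1 (ball u 1) (ball_open _ (1 : R)) (ex_intro _ u (ballxx _ (@ltr01 R))).
apply: exponentially_separated_density => n m.
rewrite -!ball_normE /= sub0r normrN => En Fm mn.
have {}En : 1 < n.+1%:R ^+ 3 * `|ellp_val x n|.
  have := le_lt_trans (ellp_coord_le _ 0%N) En.
  rewrite -[ellp_val _ _]/(ellp_val u 0%N - ellp_val (iter n _ x) 0%N) uv.
  rewrite (@iter_weighted_shift _ _ _ _ _ (fun n => n.+1%:R ^+ 3)) => [|k|//].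
    2: by rewrite exprn_gt0.
  rewrite addn0 expr1n divr1 => {}En.
  have := lerB_dist v (n.+1%:R ^+ 3 *: ellp_val x n).
  by rewrite v2 normrZ ger0_norm ?exprn_ge0//; lra.
have {}Fm : 8 ^+ m * `|ellp_val x n| < 1.
  have := le_lt_trans (ellp_coord_le _ (n - m)%N) Fm.
  rewrite (@iter_weighted_shift _ _ _ _ _ (fun n => 8 ^+ n)) => [|k|//].
    2: by rewrite exprn_gt0.
  rewrite subnKC// normrZ ger0_norm ?divr_ge0 ?exprn_ge0//.
  by rewrite -{1}(subnKC mn) exprD mulfK// expf_neq0.
have x0 : 0 < `|ellp_val x n|.
  rewrite lt_neqAle normr_ge0 andbT eq_sym; apply/eqP => x0.
  by move: En; rewrite x0 mulr0 ltr10.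
have := lt_trans Fm En; rewrite ltr_pM2r//.
rewrite (_ : 8 = 2 ^+ 3 :> R); last by rewrite -natrX.
by rewrite exprAC ltr_pXn2r ?nnegrE ?exprn_ge0// -natrX ltr_nat ltnS.
Qed.

Lemma shifts_without_common_vector (R : realType) (V : normedModType R) (p : R)
    (p1 : 1 <= p) (q : nat -> V) (v : V) :
    (forall v (e : R), 0 < e -> exists i, `|v - q i| < e) -> `|v| = 2 ->
  exists w1 w2 : shift_weight R,
    [/\ frequently_hypercyclic (weighted_shift V p1 w1),
        frequently_hypercyclic (weighted_shift V p1 w2) &
        ~ exists x : ellp V p1,
            frequently_hypercyclic_vector (weighted_shift V p1 w1) x /\
            frequently_hypercyclic_vector (weighted_shift V p1 w2) x].
Proof.
move=> qd v2.
have [w1 w1E] : exists w : shift_weight R,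
    forall n, w n.+1 = n.+2%:R ^+ 3 / n.+1%:R ^+ 3.
  apply: (@weight_of_products _ (fun n => n.+1%:R ^+ 3) 8) => n.
    by rewrite exprn_gt0.
  by rewrite -!natrX -natrM ler_nat !expnS expn0; nia.
have [w2 w2E] : exists w : shift_weight R,
    forall n, w n.+1 = 8 ^+ n.+1 / 8 ^+ n.
  apply: (@weight_of_products _ (fun n => 8 ^+ n) 8) => n.
    by rewrite exprn_gt0.
  by rewrite exprS.
exists w1, w2; split; last exact: no_common_vector v2 w1E w2E.
  exact: (@frequently_hypercyclic_of_growth _ _ _ _ _ _
    (fun n => n.+1%:R ^+ 3) qd).
apply: (@frequently_hypercyclic_of_growth _ _ _ _ _ _
  (fun n => 8 ^+ n) qd) => // n.
rewrite (_ : 8 = 2 ^+ 3 :> R); last by rewrite -natrX.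
by rewrite exprAC lerXn2r ?nnegrE// -natrX ler_nat ltn_expl.
Qed.

Lemma real_dense_sequence (R : realType) (a e : R) :
  0 < e -> exists i, `|a - ratr (odflt 0 (unpickle i))| < e.
Proof.
move=> e0; have /rat_in_itvoo[r] : a - e < a + e by lra.
rewrite in_itv /= => ar; exists (pickle r); rewrite pickleK /= ltr_norml.
by move: ar; lra.
Qed.

Lemma complex_dense_sequence (R : realType) :
  exists q : nat -> Rcomplex R,
    forall v (e : R), 0 < e -> exists i, `|v - q i| < e.
Proof.
pose f i : R := ratr (odflt 0 (unpickle i)).
pose q n : Rcomplex R :=
  let ij := odflt (0%N, 0%N) (unpickle n) in (f ij.1 +i* f ij.2)%C.
exists q => -[a b] e e0.
have e2 : 0 < e / 2 by rewrite divr_gt0.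
have [i ai] := real_dense_sequence a e2.
have [j bj] := real_dense_sequence b e2.
exists (pickle (i, j)); rewrite /q pickleK /=.
rewrite /Num.norm /= -[X in X < _]/(Num.sqrt ((a - f i) ^+ 2 + (b - f j) ^+ 2)).
rewrite -[ltRHS](ger0_norm (ltW e0)) -sqrtr_sqr ltr_sqrt ?exprn_gt0//.
move: ai bj; rewrite -!/(f _) !ltr_norml => /andP[a1 a2] /andP[b1 b2]; nra.
Qed.

Theorem corollary2p27 (R : realType) (p : R) (p1 : 1 <= p) :
  (* real scalars *)
  (exists w1 w2 : shift_weight R,
    [/\ frequently_hypercyclic (weighted_shift R^o p1 w1),
        frequently_hypercyclic (weighted_shift R^o p1 w2) &
        ~ exists x : ellp R^o p1,
            frequently_hypercyclic_vector (weighted_shift R^o p1 w1) x /\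
            frequently_hypercyclic_vector (weighted_shift R^o p1 w2) x]) /\
  (* complex scalars *)
  (exists w1 w2 : shift_weight R,
    [/\ frequently_hypercyclic (weighted_shift (Rcomplex R) p1 w1),
        frequently_hypercyclic (weighted_shift (Rcomplex R) p1 w2) &
        ~ exists x : ellp (Rcomplex R) p1,
            frequently_hypercyclic_vector
              (weighted_shift (Rcomplex R) p1 w1) x /\
            frequently_hypercyclic_vector
              (weighted_shift (Rcomplex R) p1 w2) x]).
Proof.
split.
  apply: (@shifts_without_common_vector _ R^o _ _ _ 2).
    exact: real_dense_sequence.
  by rewrite ger0_norm.
have [q qd] := complex_dense_sequence R.
apply: (@shifts_without_common_vector _ (Rcomplex R) _ _ q (2 +i* 0)%C qd).
rewrite /Num.norm /= -[LHS]/(Num.sqrt (2 ^+ 2 + 0 ^+ 2)).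
by rewrite expr0n addr0 sqrtr_sqr ger0_norm.
Qed.
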